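(* Let $(A^{\bullet},d)$ be a Poincaré duality commutative differential graded algebra of formal dimension $m$ over a field $\Bbbk$. Then: (1) $H^i(A,\delta_{a})^*\cong H^{m-i}(A,\delta_{-a})$ for all $a\in \mathrm{MC}(A)$ and $i\ge 0$. (2) The linear isomorphism $A^1\to A^1$, $a\mapsto -a$, restricts to isomorphisms $\mathcal{R}^i_s(A)\to\mathcal{R}^{m-i}_s(A)$ for all $i,s\ge 0$. (3) $\mathcal{R}^m_1(A)=\{0\}$.
   Context: A commutative differential graded algebra (cdga) over a field $\Bbbk$ (of arbitrary characteristic) is a pair $(A,d)$. Here $A=\bigoplus_{i\ge0}A^i$ is a graded, associative, unital $\Bbbk$-algebra with $ab=(-1)^{|a||b|}ba$ for homogeneous $a,b$ (so in characteristic $2$ squares of odd elements need not vanish), and $d\colon A^i\to A^{i+1}$ is $\Bbbk$-linear with $d\circ d=0$ and $d(ab)=d(a)b+(-1)^{|a|}a\,d(b)$. It is connected if $A^0=\Bbbk\cdot1$, and of finite type if each $A^i$ is finite-dimensional. $(A,d)$ is a Poincaré duality cdga of formal dimension $m$ if $A$ is connected and of finite type, there is a $\Bbbk$-linear map $\varepsilon\colon A^m\to\Bbbk$ such that the forms $A^i\otimes_{\Bbbk}A^{m-i}\to\Bbbk$, $a\otimes b\mapsto\varepsilon(ab)$, are non-singular for all $i\ge0$, and $d(A^{m-1})=0$. The Maurer–Cartan set is $\mathrm{MC}(A)=\{a\in A^1\mid a^2+d(a)=0\}$; it is invariant under $a\mapsto-a$. For $a\in\mathrm{MC}(A)$, the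 maps $\delta_a\colon A^i\to A^{i+1}$, $\delta_a(u)=au+d(u)$, form a cochain complex $(A,\delta_a)$. The resonance varieties are $$\mathcal{R}^q_s(A)=\{a\in\mathrm{MC}(A)\mid\dim_{\Bbbk}H^q(A,\delta_a)\ge s\}.$$ Graded pieces and cohomology in negative degrees are zero, and the same formula defines $\mathcal{R}^q_s(A)$ for $q<0$. $V^*$ denotes the dual vector space. *)

(* Defs.v *)
From HB Require Import structures.
From mathcomp Require Import all_boot all_order all_algebra.
From mathcomp Require Import boolp classical_sets functions.

Set Implicit Arguments.
Unset Strict Implicit.
Unset Printing Implicit Defensive.
Import GRing.Theory VectorInternalTheory.
Local Open Scope ring_scope.
Local Open Scope quotient_scope.

(* The quotient vector space V / W of a finite-dimensional space, with cosets
   of W as elements; MathComp only provides its additive group structure. *)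
Definition vquot (k : fieldType) (V : vectType k) (W : {vspace V}) : Type :=
  Quotient.quot W.

Section VQuot.
Variables (k : fieldType) (V : vectType k) (W : {vspace V}).

HB.instance Definition _ := GRing.Zmodule.on (vquot W).
HB.instance Definition _ := Quotient.on (vquot W).

Definition vquot_pi (x : V) : vquot W := \pi_(Quotient.quot W) x.

Lemma vquot_piE x y : (vquot_pi x == vquot_pi y) = (x - y \in W).
Proof. by rewrite Quotient.idealrBE. Qed.

Lemma vquot_pi_surj (q : vquot W) : {x | q = vquot_pi x}.
Proof. by exists (repr (q : Quotient.quot W)); rewrite /vquot_pi reprK. Qed.

Lemma vquot_piB x y : vquot_pi (x - y) = vquot_pi x - vquot_pi y.
Proof. exact: (raddfB (\pi_(Quotient.quot W))). Qed.
Lemma vquot_piD x y : vquot_pi (x + y) = vquot_pi x + vquot_pi y.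
Proof. exact: (raddfD (\pi_(Quotient.quot W))). Qed.

Definition vquot_scale (c : k) (q : vquot W) : vquot W :=
  vquot_pi (c *: repr (q : Quotient.quot W)).

Lemma vquot_scale_pi c x : vquot_scale c (vquot_pi x) = vquot_pi (c *: x).
Proof.
apply/eqP; rewrite vquot_piE -scalerBr memvZ //.
by rewrite -vquot_piE /vquot_pi reprK.
Qed.

Fact vquot_scaleA a b q :
  vquot_scale a (vquot_scale b q) = vquot_scale (a * b) q.
Proof. by have [x ->] := vquot_pi_surj q; rewrite !vquot_scale_pi scalerA. Qed.
Fact vquot_scale1 : left_id 1 vquot_scale.
Proof.
by move=> q; have [x ->] := vquot_pi_surj q; rewrite vquot_scale_pi scale1r.
Qed.
Fact vquot_scaleDr : right_distributive vquot_scale +%R.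
Proof.
move=> a p q; have [x ->] := vquot_pi_surj p; have [y ->] := vquot_pi_surj q.
by rewrite -vquot_piD !vquot_scale_pi scalerDr vquot_piD.
Qed.
Fact vquot_scaleDl q : {morph vquot_scale^~ q : a b / a + b}.
Proof.
move=> a b; have [x ->] := vquot_pi_surj q.
by rewrite !vquot_scale_pi scalerDl vquot_piD.
Qed.

HB.instance Definition _ := GRing.Zmodule_isLmodule.Build k (vquot W)
  vquot_scaleA vquot_scale1 vquot_scaleDr vquot_scaleDl.

Lemma vquot_pi_is_linear : linear vquot_pi.
Proof. by move=> a x y; rewrite vquot_piD -vquot_scale_pi. Qed.
HB.instance Definition _ := GRing.isLinear.Build k V (vquot W) _ vquot_pi
  vquot_pi_is_linear.

Let S : vectType k := subvs_of W^C%VS.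
Let coords (q : vquot W) : 'rV[k]_(dim S) :=
  v2r (vsproj W^C (daddv_pi W^C W (repr (q : Quotient.quot W)))).

Fact vquot_vect_axiom : Vector.axiom (dim S) (vquot W).
Proof.
have tr : (W^C :&: W = 0)%VS by rewrite capvC capv_compl.
have trC : (W :&: W^C = 0)%VS by rewrite capv_compl.
have coords_pi x : coords (vquot_pi x) = v2r (vsproj W^C (daddv_pi W^C W x)).
  rewrite /coords; congr v2r; apply/eqP; rewrite -subr_eq0 -!linearB /=.
  set y := repr _ - x.
  have yW : y \in W by rewrite -vquot_piE /vquot_pi reprK.
  have: daddv_pi W^C W y + daddv_pi W W^C y = y.
    by rewrite daddv_pi_add // addvC addv_complf memvf.
  rewrite (daddv_pi_id trC yW) => /(canRL (addrK _)); rewrite subrr => ->.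
  by rewrite linear0.
exists coords.
  move=> a p q; have [x ->] := vquot_pi_surj p.
  by have [y ->] := vquot_pi_surj q; rewrite -linearP !coords_pi !linearP.
exists (fun r => vquot_pi (vsval (r2v r : S))) => [q|r].
  have [x ->] := vquot_pi_surj q; rewrite coords_pi v2rK.
  rewrite vsprojK ?memv_pi //; apply/eqP; rewrite vquot_piE.
  have {2}<-: daddv_pi W^C W x + daddv_pi W W^C x = x.
    by rewrite daddv_pi_add // addvC addv_complf memvf.
  by rewrite opprD addNKr memvN memv_pi.
rewrite coords_pi; apply: (canLR r2vK); apply/val_inj.
by rewrite /= vsprojK ?memv_pi // daddv_pi_id ?subvsP.
Qed.

HB.instance Definition _ :=
  Lmodule_hasFinDim.Build k (vquot W) vquot_vect_axiom.
End VQuot.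

(* A commutative differential graded algebra of finite type over k, given by its
   graded pieces: A = \bigoplus_i gr A i. The pieces are indexed by int and
   vanish in negative degrees; finite type is built into vectType. Products and
   differentials take their target degree up to a propositional equality, so
   that no transport between gr A (i + (j + l)) and gr A (i + j + l) occurs.
   No relation is imposed on squares of odd elements in characteristic 2. *)
Record cdga (k : fieldType) := Cdga {
  gr : int -> vectType k;
  gr_neg : forall i (a : gr i), i < 0 -> a = 0;
  gmul : forall i j n, i + j = n -> 'Hom(gr i, 'Hom(gr j, gr n));
  gone : gr 0;
  gdiff : forall i n, 1 + i = n -> 'Hom(gr i, gr n);
  gmulA : forall i j l ij jl n (e1 : i + j = ij) (e2 : ij + l = n)
      (e3 : j + l = jl) (e4 : i + jl = n) (a : gr i) (b : gr j) (c : gr l),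
    gmul e2 (gmul e1 a b) c = gmul e4 a (gmul e3 b c);
  gmul1l : forall i (e : 0 + i = i) (a : gr i), gmul e gone a = a;
  gmul1r : forall i (e : i + 0 = i) (a : gr i), gmul e a gone = a;
  gmulC : forall i j n (e : i + j = n) (e' : j + i = n) (a : gr i) (b : gr j),
    gmul e a b = (-1) ^ (i * j) *: gmul e' b a;
  gdiffK : forall i j n (e : 1 + i = j) (e' : 1 + j = n) (a : gr i),
    gdiff e' (gdiff e a) = 0;
  gdiffM : forall i j n i' j' n' (e : i + j = n) (ei : 1 + i = i')
      (ej : 1 + j = j') (en : 1 + n = n') (e1 : i' + j = n') (e2 : i + j' = n')
      (a : gr i) (b : gr j),
    gdiff en (gmul e a b)
      = gmul e1 (gdiff ei a) b + (-1) ^ i *: gmul e2 a (gdiff ej b)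
}.

Arguments gmul {k} _ {i j n} e.
Arguments gdiff {k} _ {i n} e.

Definition dual (k : fieldType) (V : vectType k) : vectType k := 'Hom(V, k^o).

Definition linear_iso (k : fieldType) (V W : vectType k) : Prop :=
  exists f : 'Hom(V, W), bijective f.

Section PoincareDuality.
Variables (k : fieldType) (A : cdga k).

Definition connected : Prop :=
  gone A != 0 /\ fullv = <[gone A]>%VS.

(* The form a, b |-> eps (a b) on A^i and A^j, seen as a map A^i -> (A^j)^*. *)
Definition pd_form (m : int) (eps : 'Hom(gr A m, k^o)) i j (e : i + j = m)
    (a : gr A i) : dual (gr A j) :=
  (eps \o gmul A e a)%VF.

Definition poincare_duality (m : nat) : Prop :=
  [/\ connected,
      exists eps : 'Hom(gr A m, k^o),
        forall (i : nat) (e : i%:Z + (m%:Z - i%:Z) = m%:Z),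
          bijective (pd_form eps e)
    & forall (e : 1 + (m%:Z - 1) = m%:Z) (u : gr A (m%:Z - 1)),
        gdiff A e u = 0].

End PoincareDuality.

Section Resonance.
Variables (k : fieldType) (A : cdga k).
Local Open Scope classical_set_scope.

Definition MC : set (gr A 1) :=
  [set a | gmul A (erefl (1 + 1)) a a + gdiff A (erefl (1 + 1)) a = 0].

Definition twdiff (a : gr A 1) i n (e : 1 + i = n) : 'Hom(gr A i, gr A n) :=
  gmul A e a + gdiff A e.

Lemma twdiffK a i j n (e : 1 + i = j) (e' : 1 + j = n) :
  MC a -> (twdiff a e' \o twdiff a e = 0)%VF.
Proof.
move=> MCa; apply/lfunP => u.
have e2 : (1 + 1) + i = n by rewrite -addrA e.
rewrite comp_lfunE /= !add_lfunE zero_lfunE !linearD /= gdiffK addr0.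
rewrite (gdiffM e (erefl _) e e' e2 e') -(gmulA (erefl _) e2 e e').
rewrite expr1z scaleN1r addrACA subrr addr0 -add_lfunE -linearD.
by rewrite (MCa : _ + _ = 0) linear0 zero_lfunE.
Qed.

Definition cocycles (a : gr A 1) (q : int) : {vspace gr A q} :=
  lker (twdiff a (erefl (1 + q))).

Definition coboundaries (a : gr A 1) (q : int) : {vspace gr A q} :=
  limg (twdiff a (subrKC 1 q : 1 + (q - 1) = q)).

Lemma coboundaries_sub a q :
  MC a -> (coboundaries a q <= cocycles a q)%VS.
Proof.
move=> MCa; apply/subvP => _ /memv_imgP[u _ ->].
by rewrite memv_ker -comp_lfunE twdiffK // zero_lfunE.
Qed.

(* H^q(A, delta_a), the space of cocycles modulo the coboundaries in it. *)
Definition cohomology (a : gr A 1) (q : int) : vectType k :=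
  vquot (linfun (vsval : subvs_of (cocycles a q) -> gr A q)
           @^-1: coboundaries a q)%VS.

Definition resonance (q : int) (s : nat) : set (gr A 1) :=
  [set a | MC a /\ (s <= \dim {: cohomology a q})%N].

End Resonance.

Arguments MC {k} A.
Arguments resonance {k} A q s.

(* Main.v *)
(** By graded commutativity and the Leibniz rule, [(delta_a u) v] and
    [u (delta_{-a} v)] agree up to sign in [A^m], because [d (u v) = 0] there.
    So [delta_a] and [delta_{-a}] are adjoint up to sign for the duality pairing,
    hence have equal ranks in complementary degrees. As the dimensions of the
    graded pieces are symmetric too, so are those of the cohomology groups. Over
    a field the isomorphisms follow by counting dimensions. Finally [H^m] has the
    dimension of [H^0], which vanishes unless [a = 0] as [delta_a c = c a] on
    scalars. *)
Require Import Defs.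
From HB Require Import structures.
From mathcomp Require Import all_boot all_order all_algebra.
From mathcomp Require Import zify.
From mathcomp Require Import boolp classical_sets functions.

Set Implicit Arguments.
Unset Strict Implicit.
Unset Printing Implicit Defensive.
Import GRing.Theory VectorInternalTheory.
Local Open Scope ring_scope.
Local Open Scope classical_set_scope.

Lemma linear_iso_dim (k : fieldType) (V W : vectType k) :
  dim V = dim W -> linear_iso V W.
Proof.
move=> e.
pose f (v : V) : W := r2v (castmx (erefl, e) (v2r v)).
pose g (w : W) : V := r2v (castmx (esym erefl, esym e) (v2r w)).
(* [e] equates two compound terms; with variables [p] and [q] the equality can be eliminated. *)
have cl (p q : nat) (e' : p = q) (c : k) (x y : 'rV[k]_p) :
    castmx (erefl, e') (c *: x + y)
    = c *: castmx (erefl, e') x + castmx (erefl, e') y.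
  by case: q / e'; rewrite !castmx_id.
have lf : linear f by move=> c x y; rewrite /f linearP cl linearP.
pose fL := GRing.isLinear.Build k V W _ f lf.
pose F : {linear V -> W} := HB.pack f fL.
exists (linfun F); exists g => x; rewrite !lfunE /= /f /g.
  by rewrite r2vK castmxK v2rK.
by rewrite r2vK castmxKV v2rK.
Qed.

Lemma dim_vquot (k : fieldType) (V : vectType k) (W : {vspace V}) :
  \dim {: vquot W} = (dim V - \dim W)%N.
Proof. by rewrite dimvf -[dim V]dimvf -dimv_compl. Qed.

(* [P] induces a map from [V] to the dual of [limg g], whose kernel lies in
   [lker f]. *)
Lemma dim_limg_le_pairing (k : fieldType) (V W V' W' : vectType k)
    (f : 'Hom(V, W)) (g : 'Hom(V', W')) (P : 'Hom(V, 'Hom(W', k^o))) :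
  (forall u, (forall v, P u (g v) = 0) -> f u = 0) ->
  (\dim (limg f) <= \dim (limg g))%N.
Proof.
move=> Pf; pose S := subvs_of (limg g).
pose r (u : V) : 'Hom(S, k^o) := (P u \o linfun vsval)%VF.
have lr : linear r.
  by move=> c x y; rewrite /r linearP comp_lfunDl comp_lfunZl.
pose R : {linear V -> 'Hom(S, k^o)} :=
  HB.pack r (GRing.isLinear.Build k _ _ _ r lr).
pose h := linfun R.
have kerh : (lker h <= lker f)%VS.
  apply/subvP => u; rewrite !memv_ker lfunE /= => /eqP ru0.
  apply/eqP/Pf => v.
  have gv : g v \in limg g by rewrite memv_img ?memvf.
  have := congr1 (fun q : 'Hom(S, k^o) => q (Subvs gv)) ru0.
  by rewrite comp_lfunE lfunE zero_lfunE.
have hV := limg_ker_dim h fullv; have fV := limg_ker_dim f fullv.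
rewrite !capfv in hV fV.
(* [limg h] lies in the dual of [S], whose dimension computes to that of [S] times 1. *)
have hS : (\dim (limg h) <= \dim (limg g))%N.
  by have := dimvS (subvf (limg h)); rewrite dimvf /dim /= muln1.
by have := dimvS kerh; lia.
Qed.

(** Rank-nullity gives the dimension of the cocycles. Since they contain the coboundaries, pulling
    these back along the injective inclusion keeps their dimension. *)
Lemma dim_cohomology (k : fieldType) (A : cdga k) (a : gr A 1) (q : int) :
  MC A a ->
  \dim {: cohomology a q} =
    (dim (gr A q) - \dim (limg (twdiff a (erefl (1 + q)%R)))
    - \dim (limg (twdiff a (subrKC 1 q))))%N.
Proof.
move=> MCa; rewrite dim_vquot.
set f := linfun _.
have fE x : f x = vsval x by rewrite lfunE.
have f0 : lker f = 0%VS.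
  apply/eqP/lker0P => x y; rewrite !fE; exact: val_inj.
have fI : (coboundaries a q <= limg f)%VS.
  apply: subv_trans (coboundaries_sub q MCa) _; apply/subvP => x xC.
  by rewrite -[x]/(vsval (Subvs xC)) -fE memv_img ?memvf.
rewrite -[in X in (_ - X)%N](limg_dim_eq (f := f)) ?f0 ?capv0 //.
rewrite lpreimK // /coboundaries; congr (_ - _)%N.
have := limg_ker_dim (twdiff a (erefl (1 + q))) fullv.
by rewrite capfv dimvf /dim /= => <-; rewrite addnK.
Qed.

(** The differential terms match by the Leibniz rule for [u v]. Moving [a] past [u] costs only
    [(-1) ^ i]; the missing minus sign comes from [- a] on the right. *)
Lemma twdiff_adjoint (k : fieldType) (A : cdga k) (a : gr A 1) (m i j i' j' : int)
    (ei : 1 + i = i') (ej : 1 + j = j') (e1 : i' + j = m) (e2 : i + j' = m)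
    (u : gr A i) (v : gr A j) :
  (forall n (e : 1 + n = m) (w : gr A n), gdiff A e w = 0) ->
  gmul A e1 (twdiff a ei u) v
    = - (-1) ^ i *: gmul A e2 u (twdiff (- a) ej v).
Proof.
move=> d0.
have en : 1 + (i + j) = m by rewrite addrA ei.
have e' : i + 1 = i' by rewrite addrC.
have := gdiffM (erefl (i + j)) ei ej en e1 e2 u v.
rewrite d0 /twdiff !add_lfunE !linearD /= add_lfunE => /esym/eqP.
rewrite addr_eq0 => /eqP ->.
rewrite (gmulC ei e') mul1r linearZ /= scale_lfunE (gmulA e' e1 ej e2).
by rewrite linearN opp_lfunE linearN scaleNr scalerN opprK scaleNr.
Qed.

Section PdFormLinear.
Variables (k : fieldType) (A : cdga k) (m : int) (eps : 'Hom(gr A m, k^o)).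
Variables (i j : int) (e : i + j = m).

Lemma pd_form_is_linear : linear (pd_form eps e).
Proof. by move=> c x y; rewrite /pd_form linearP comp_lfunDr comp_lfunZr. Qed.

HB.instance Definition _ :=
  GRing.isLinear.Build k _ _ _ (pd_form eps e) pd_form_is_linear.
End PdFormLinear.

Section Duality.
Variables (k : fieldType) (A : cdga k) (m : nat).
Hypothesis hA : poincare_duality A m.

Lemma gdiff_top n (e : 1 + n = m%:Z) (u : gr A n) : gdiff A e u = 0.
Proof.
have En : n = m%:Z - 1 by rewrite -e addrC addKr.
by case: hA => _ _ d0; subst n; apply: d0.
Qed.

Lemma dim_gr_dual (i : nat) : dim (gr A i%:Z) = dim (gr A (m%:Z - i%:Z)).
Proof.
case: hA => _ [eps /(_ i (subrKC _ _)) bij_eps] _.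
pose f := linfun (pd_form eps (subrKC i%:Z m%:Z)).
have f_bij : bijective f by apply: (eq_bij bij_eps) => x; rewrite lfunE.
have f0 : lker f = 0%VS by apply/eqP/lker0P/bij_inj.
have fT : limg f = fullv.
  apply/vspaceP => y; rewrite memvf; case: f_bij => g _ fg.
  by rewrite -[y]fg memv_img ?memvf.
have := limg_dim_eq (f := f) (U := fullv).
by rewrite f0 capv0 fT !dimvf {1}/dim /= muln1 => ->.
Qed.

(** If [u] pairs to zero with the image of [twdiff (- a) ej], then by adjointness [twdiff a ei u]
    pairs to zero with everything, so it vanishes. *)
Lemma dim_limg_twdiff_le (a : gr A 1) (i j i' j' : int)
    (ei : 1 + i = i') (ej : 1 + j = j') (e : i' + j = m%:Z) :
  (\dim (limg (twdiff a ei)) <= \dim (limg (twdiff (- a) ej)))%N.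
Proof.
case: hA => _ [eps eps_bij] _.
have nondeg x : (forall y, eps (gmul A e x y) = 0) -> x = 0.
  (* Duality is assumed in natural degrees only; in negative ones [x] is already zero. *)
  case: i' x e {ei} => [p|p] x e x0; last by apply: gr_neg.
  have Ej : j = m%:Z - p%:Z by rewrite -e addrC addKr.
  move: e x0; rewrite Ej => e x0; have /bij_inj := eps_bij p e; apply.
  by apply/lfunP => y; rewrite /pd_form !comp_lfunE x0 linear0 zero_lfunE linear0.
have e2 : i + j' = m%:Z by rewrite -e -ei -ej addrCA addrA.
apply: (@dim_limg_le_pairing _ _ _ _ _ _ _ (linfun (pd_form eps e2))) => u Pu.
apply: nondeg => v.
rewrite (twdiff_adjoint a ei ej e e2) ?linearZ /=; last exact: gdiff_top.
by have := Pu v; rewrite lfunE /= comp_lfunE => ->; rewrite scaler0.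
Qed.

Lemma dim_limg_twdiff (a : gr A 1) (i j i' j' : int)
    (ei : 1 + i = i') (ej : 1 + j = j') (e : i' + j = m%:Z) :
  \dim (limg (twdiff a ei)) = \dim (limg (twdiff (- a) ej)).
Proof.
apply/eqP; rewrite eqn_leq dim_limg_twdiff_le //=.
(* The reverse inequality is the same bound for [- a], with the two differentials exchanged. *)
have e' : j' + i = m%:Z by rewrite -e -ei -ej addrAC.
by rewrite -{2}[a]opprK dim_limg_twdiff_le.
Qed.

Lemma dim_cohomology_dual (a : gr A 1) (i : nat) : MC A a -> MC A (- a) ->
  \dim {: cohomology a i%:Z} = \dim {: cohomology (- a) (m%:Z - i%:Z)}.
Proof.
move=> MCa MCNa; rewrite !dim_cohomology // dim_gr_dual -subnDA addnC subnDA.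
congr (_ - _ - _)%N; apply: dim_limg_twdiff; lia.
Qed.

(** The Leibniz rule for [1 = 1 * 1] reads [d 1 = d 1 + d 1], which cancels in every
    characteristic. *)
Lemma gdiff_one n (e : 1 + 0 = n) : gdiff A e (gone A) = 0.
Proof.
have en : n + 0 = n by rewrite addr0.
have en' : 0 + n = n by rewrite add0r.
have := gdiffM (addr0 0) e e e en en' (gone A) (gone A).
rewrite gmul1r gmul1r gmul1l expr0z scale1r => /eqP.
by rewrite -subr_eq0 opprD addNKr oppr_eq0 => /eqP.
Qed.

Lemma twdiff_one (a : gr A 1) (e : 1 + 0 = 1) : twdiff a e (gone A) = a.
Proof. by rewrite /twdiff add_lfunE gmul1r gdiff_one addr0. Qed.

Lemma dim_gr0 : dim (gr A 0) = 1%N.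
Proof. by case: hA => -[one0 gr0E] _ _; rewrite -dimvf gr0E dim_vline one0. Qed.

(** Nothing comes in from degree -1, and the outgoing image is the line spanned by [a], so the
    dimension is 1 minus the rank of [a]. *)
Lemma dim_cohomology0_gt0 (a : gr A 1) : MC A a ->
  (0 < \dim {: cohomology a 0})%N = (a == 0).
Proof.
move=> MCa; rewrite dim_cohomology // dim_gr0.
have one_full : fullv = <[gone A]>%VS by case: hA => -[].
have limg_neg : limg (twdiff a (subrKC 1 0)) = 0%VS.
  apply/eqP; rewrite -subv0; apply/subvP => _ /memv_imgP[u _ ->].
  by rewrite (gr_neg u) // linear0 mem0v.
(* The degree [1 + 0] computes to [1], so [twdiff_one] applies after a change of equality proof. *)
have e1 : 1 + 0 = 1 :> int by [].
rewrite limg_neg dimv0 subn0 one_full limg_line.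
rewrite (eq_irrelevance (erefl _) e1) twdiff_one dim_vline.
by case: eqP.
Qed.

End Duality.

(** Graded commutativity gives [a^2 = - a^2], even where [a^2] is nonzero in characteristic 2. Hence
    [a^2 - d a = - (a^2 + d a)]. *)
Lemma MC_opp (k : fieldType) (A : cdga k) (a : gr A 1) : MC A a -> MC A (- a).
Proof.
rewrite /MC /= => MCa.
have sqN : gmul A (erefl (1 + 1)) a a = - gmul A (erefl (1 + 1)) a a.
  by rewrite {1}(gmulC _ (erefl (1 + 1))) mulr1 expr1z scaleN1r.
rewrite !linearN /= opp_lfunE opprK {1}sqN -opprD.
by rewrite (MCa : _ + _ = 0) oppr0.
Qed.

Lemma MC0 (k : fieldType) (A : cdga k) : MC A 0.
Proof. by rewrite /MC /= !linear0 addr0. Qed.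

Theorem theorem4p6 (k : fieldType) (A : cdga k) (m : nat)
    (hA : poincare_duality A m) :
  [/\ (forall (a : gr A 1) (i : nat), MC A a ->
         linear_iso (dual (cohomology a i%:Z)) (cohomology (- a) (m%:Z - i%:Z))),
      (forall i s : nat,
         set_bij (resonance A i%:Z s) (resonance A (m%:Z - i%:Z) s)
           (fun a : gr A 1 => - a))
    & resonance A m%:Z 1 = [set 0]].
Proof.
have dual_dim a i : MC A a ->
    \dim {: cohomology a i%:Z} = \dim {: cohomology (- a) (m%:Z - i%:Z)}.
  by move=> MCa; apply: dim_cohomology_dual => //; apply: MC_opp.
split=> [a i MCa | i s | ].
- apply: linear_iso_dim; apply: etrans (muln1 _) _.
  by rewrite -[LHS]dimvf dual_dim // dimvf.
- split=> [a [MCa sa] | a b _ _ | b [MCb sb]].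
  + by split; [apply: MC_opp | rewrite -dual_dim].
  + exact: oppr_inj.
  + exists (- b); last exact: opprK.
    by split; [apply: MC_opp | rewrite dual_dim ?opprK //; apply: MC_opp].
(* Duality at [i = m] reduces both inclusions to degree [m - m = 0]. *)
- apply/seteqP; split=> [a [MCa] | _ ->].
    rewrite dual_dim // subrr (dim_cohomology0_gt0 hA); last exact: MC_opp.
    by rewrite oppr_eq0 => /eqP.
  split; first exact: MC0.
  rewrite dual_dim ?oppr0 ?subrr; last exact: MC0.
  by rewrite (dim_cohomology0_gt0 hA) //; exact: MC0.
Qed.
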